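(* For every fixed integer $k\ge 1$, there are only finitely many (up to isomorphism) $k$-vertex-critical $(P_5,\text{diamond})$-free graphs.
   Context: All graphs are finite and simple. $P_5$ is the path on 5 vertices. The diamond is the graph obtained from $K_4$ by deleting one edge (the complement of $P_2+2P_1$). A graph is $(P_5,\text{diamond})$-free if it has no induced subgraph isomorphic to $P_5$ or to the diamond. A graph $G$ is $k$-vertex-critical if $\chi(G)=k$ and $\chi(G-v)<k$ for every vertex $v$, where $\chi$ is the chromatic number. *)

(* Defs.v *)
From mathcomp Require Import all_boot.

Set Implicit Arguments.
Unset Strict Implicit.
Unset Printing Implicit Defensive.

Record sgraph := SGraph {
  vertex :> finType;
  edge : rel vertex;
  edge_sym : symmetric edge;
  edge_irrefl : irreflexive edge }.

Definition isomorphic (G H : sgraph) : Prop :=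
  exists f : G -> H, bijective f /\ forall x y : G, edge (f x) (f y) = edge x y.

Section Induced.
Variables (G : sgraph) (A : {set G}).

Definition induced_edge : rel {x : G | x \in A} :=
  fun x y => edge (val x) (val y).

Lemma induced_edge_sym : symmetric induced_edge.
Proof. by move=> x y; apply: edge_sym. Qed.

Lemma induced_edge_irrefl : irreflexive induced_edge.
Proof. by move=> x; apply: edge_irrefl. Qed.

Definition induced : sgraph := SGraph induced_edge_sym induced_edge_irrefl.

End Induced.

Definition induced_free (H G : sgraph) : Prop :=
  forall A : {set G}, ~ isomorphic (induced A) H.

Definition del_vertex (G : sgraph) (v : G) : sgraph := induced [set~ v].

Definition colorable (G : sgraph) (k : nat) : bool :=
  [exists c : {ffun G -> 'I_k},
     [forall x, forall y, edge x y ==> (c x != c y)]].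

Lemma colorable_exists (G : sgraph) : exists k, colorable G k.
Proof.
exists #|G|; apply/existsP; exists [ffun x => enum_rank x].
apply/forallP=> x; apply/forallP=> y; apply/implyP=> xy.
rewrite !ffunE (inj_eq enum_rank_inj); apply/eqP=> exy.
by rewrite exy edge_irrefl in xy.
Qed.

Definition chi (G : sgraph) : nat := ex_minn (colorable_exists G).

Definition vertex_critical (k : nat) (G : sgraph) : Prop :=
  chi G = k /\ forall v : G, chi (del_vertex v) < k.

Definition P5_edge : rel 'I_5 :=
  fun i j => (i.+1 == j :> nat) || (j.+1 == i :> nat).

Lemma P5_edge_sym : symmetric P5_edge.
Proof. by move=> i j; rewrite /P5_edge orbC. Qed.

Lemma P5_edge_irrefl : irreflexive P5_edge.
Proof. by move=> i; rewrite /P5_edge orbb gtn_eqF. Qed.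

Definition P5 : sgraph := SGraph P5_edge_sym P5_edge_irrefl.

(* The edge deleted from K_4 is the one joining 0 and 1. *)
Definition diamond_edge : rel 'I_4 :=
  fun i j => (i != j) && ~~ ((i < 2) && (j < 2)).

Lemma diamond_edge_sym : symmetric diamond_edge.
Proof. by move=> i j; rewrite /diamond_edge eq_sym andbC [in RHS]andbC [(j < 2) && _]andbC. Qed.

Lemma diamond_edge_irrefl : irreflexive diamond_edge.
Proof. by move=> i; rewrite /diamond_edge eqxx. Qed.

Definition diamond : sgraph := SGraph diamond_edge_sym diamond_edge_irrefl.

Definition finitely_many_up_to_iso (P : sgraph -> Prop) : Prop :=
  exists (n : nat) (H : 'I_n -> sgraph),
    forall G : sgraph, P G -> exists i : 'I_n, isomorphic G (H i).

(* Main.v *)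
Require Import Defs.
From mathcomp Require Import all_boot.

(** A critical graph is connected, and a connected P5-free graph is a ball of
    radius three, so it suffices to bound the degree of a vertex [d].

    By diamond-freeness [N(d)] is a disjoint union of cliques, and the sets
    [R(a) = N(a) \ N[d]] are disjoint for [a] in the same clique. For nonadjacent
    [a, a'] in [N(d)], P5-freeness makes [R(a) \ R(a')] complete to
    [R(a') \ R(a)]. If [N(d)] is large, Ramsey's theorem gives many of its
    cliques, all of one size, labelled so that the inclusions between the
    [R(a_i^p)] and [R(a_j^p)], [i < j], depend only on [p]. Criticality forbids
    folding one clique onto another, so for some label [p] the [R(a_i^p)] are
    pairwise incomparable, or for some [p <> q] the [R(a_i^p)] strictly decrease
    while the [R(a_i^q)] strictly increase. The first case produces a large
    clique, the second a diamond or a P5. *)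

Set Implicit Arguments.
Unset Strict Implicit.
Unset Printing Implicit Defensive.

(** * Ramsey's theorem for sequences *)

(** Induction on the sum of the targets: pigeonhole gives a colour frequent from the head, whose
    target drops by one in the tail. Colours are read in list order only, so [col] may be
    asymmetric, as the inclusion colours used later are. *)
Lemma ramsey_off_diagonal (C : finType) (c0 : C) (n : nat) :
  exists N, forall (f : C -> nat), \sum_c f c <= n ->
  forall (T : eqType) (col : T -> T -> C) (s : seq T), N <= size s ->
  exists c t, [/\ subseq t s, f c <= size t & pairwise (fun x y => col x y == c) t].
Proof.
elim: n => [|n [N IHn]].
  exists 0 => f f0 T col s _; exists c0, [::]; split=> //; first exact: sub0seq.
  by move: f0; rewrite leqn0 sum_nat_eq0 => /forallP/(_ c0)/eqP->.
exists (#|C| * N).+1 => f fn T col [//|x s] /= sN.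
have [c cN] : exists c, N <= count (fun y => col x y == c) s.
  case: (pickP (fun c => N <= count (fun y => col x y == c) s)) => [c cN|none].
    by exists c.
  (* If each colour occurred fewer than [N] times, the tail would be shorter than [#|C| * N]. *)
  suff: size s <= \sum_(c : C) N.-1.
    have N0 : 0 < N by case: (N) (none c0).
    rewrite sum_nat_const => h; rewrite ltnS in sN; move: (leq_trans sN h).
    rewrite leq_mul2l -ltnS prednK // ltnn orbF => /eqP C0.
    by have := max_card (pred1 c0); rewrite C0 card1.
  have -> : size s = \sum_(c : C) count (fun y => col x y == c) s.
    elim: (s) => [|y s' IH] /=; first by rewrite big1.
    rewrite big_split /= -IH (bigD1 (col x y)) //= eqxx big1 // => c ne.
    by rewrite eq_sym (negbTE ne).
  apply: leq_sum => c _; move: (none c) => /negbT; rewrite -ltnNge.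
  by case: (N).
have [fc0|fc] := posnP (f c).
  by exists c, [::]; split=> //; rewrite ?sub0seq ?fc0.
pose g c' := if c' == c then (f c).-1 else f c'.
have gn : \sum_c' g c' <= n.
  move: fn; rewrite (bigD1 c) //= [X in _ -> X <= _](bigD1 c) //= {1}/g eqxx.
  rewrite -(prednK fc) addSn ltnS; congr (_ + _ <= _).
  by apply: eq_bigr => c' /negbTE ne; rewrite /g ne.
have [|c' [t [ts tg pt]]] := IHn g gn T col [seq y <- s | col x y == c].
  by rewrite size_filter.
have {}ts' : subseq t s := subseq_trans ts (filter_subseq _ _).
move: tg; rewrite /g; case: eqP => [ec|_] tg; last first.
  by exists c', t; split=> //; apply: subseq_trans ts' (subseq_cons _ _).
exists c, (x :: t); split; rewrite /= ?eqxx //.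
  by rewrite -(prednK fc) ltnS.
rewrite -ec pt andbT; apply/allP => y /(mem_subseq ts).
by rewrite mem_filter ec => /andP[].
Qed.

Lemma ramsey (C : finType) (c0 : C) (n : nat) :
  exists N, forall (T : eqType) (col : T -> T -> C) (s : seq T), N <= size s ->
  exists c t, [/\ subseq t s, n <= size t & pairwise (fun x y => col x y == c) t].
Proof.
have [N HN] := ramsey_off_diagonal c0 (\sum_(c : C) n).
by exists N => T col s /(HN (fun=> n)); apply.
Qed.

(** * Forbidden induced subgraphs *)

Section InducedFree.
Variable G : sgraph.

Lemma induced_free_embedding (H : sgraph) (f : H -> G) :
  induced_free H G -> injective f ->
  (forall x y, edge (f x) (f y) = edge x y) -> False.
Proof.
move=> HG finj fe; apply: (HG [set f x | x in H]).
have fP x : f x \in [set f x | x in H] by apply: imset_f.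
pose F (x : H) : induced [set f x | x in H] := exist _ (f x) (fP x).
have Finj : injective F by move=> x y [] /finj.
have [|g Fg gF] := inj_card_bij Finj.
  by rewrite card_sig card_imset.
exists g; split; first by exists F.
by move=> x y; rewrite -fe -[in RHS](gF x) -[in RHS](gF y).
Qed.

Lemma no_P5 (x0 x1 x2 x3 x4 : G) : induced_free P5 G ->
  edge x0 x1 -> edge x1 x2 -> edge x2 x3 -> edge x3 x4 ->
  ~~ edge x0 x2 -> ~~ edge x0 x3 -> ~~ edge x0 x4 ->
  ~~ edge x1 x3 -> ~~ edge x1 x4 -> ~~ edge x2 x4 -> False.
Proof.
move=> P5G e01 e12 e23 e34.
move=> /negbTE n02 /negbTE n03 /negbTE n04 /negbTE n13 /negbTE n14 /negbTE n24.
pose f (i : P5) : G := nth x0 [:: x0; x1; x2; x3; x4] (i : 'I_5).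
have fe i j : edge (f i) (f j) = edge i j.
  rewrite /f; case: i => [[|[|[|[|[|i]]]]] Hi] //; case: j => [[|[|[|[|[|j]]]]] Hj] //=;
  by rewrite ?edge_irrefl // ?[edge x1 x0]edge_sym ?[edge x2 x0]edge_sym ?[edge x3 x0]edge_sym
    ?[edge x4 x0]edge_sym ?[edge x2 x1]edge_sym ?[edge x3 x1]edge_sym ?[edge x4 x1]edge_sym
    ?[edge x3 x2]edge_sym ?[edge x4 x2]edge_sym ?[edge x4 x3]edge_sym
    ?(e01, e12, e23, e34, n02, n03, n04, n13, n14, n24).
apply: (induced_free_embedding P5G _ fe) => i j fij.
(* Injectivity is automatic: distinct vertices of [P5] have distinct neighbourhoods. *)
have E l : edge i l = edge j l by rewrite -!fe fij.
apply/val_inj; move: {fij} E.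
case: i => [[|[|[|[|[|i]]]]] Hi] //; case: j => [[|[|[|[|[|j]]]]] Hj] //= E;
  by move: (E (@Ordinal 5 0 isT)) (E (@Ordinal 5 1 isT)) (E (@Ordinal 5 2 isT))
    (E (@Ordinal 5 3 isT)).
Qed.

Lemma no_diamond (x0 x1 x2 x3 : G) : induced_free diamond G ->
  x0 != x1 -> ~~ edge x0 x1 -> edge x2 x3 ->
  edge x0 x2 -> edge x0 x3 -> edge x1 x2 -> edge x1 x3 -> False.
Proof.
move=> DG ne /negbTE n01 e23 e02 e03 e12 e13.
pose f (i : diamond) : G := nth x0 [:: x0; x1; x2; x3] (i : 'I_4).
have fe i j : edge (f i) (f j) = edge i j.
  rewrite /f; case: i => [[|[|[|[|i]]]] Hi] //; case: j => [[|[|[|[|j]]]] Hj] //=;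
  by rewrite ?edge_irrefl // ?[edge x1 x0]edge_sym ?[edge x2 x0]edge_sym ?[edge x3 x0]edge_sym
    ?[edge x2 x1]edge_sym ?[edge x3 x1]edge_sym ?[edge x3 x2]edge_sym
    ?(n01, e23, e02, e03, e12, e13).
apply: (induced_free_embedding DG _ fe) => i j fij.
(* Only 0 and 1 have equal neighbourhoods in the diamond; [x0 != x1] separates them. *)
have E l : edge i l = edge j l by rewrite -!fe fij.
apply/val_inj; move: fij E.
case: i => [[|[|[|[|i]]]] Hi] //; case: j => [[|[|[|[|j]]]] Hj] //= fij E;
  try (by move: (E (@Ordinal 4 0 isT)) (E (@Ordinal 4 1 isT)) (E (@Ordinal 4 2 isT))
    (E (@Ordinal 4 3 isT))); by rewrite /f /= in fij; rewrite fij eqxx in ne.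
Qed.

End InducedFree.

(** * Vertex-critical graphs *)

Section Critical.
Variables (G : sgraph) (k : nat).
Hypothesis Gcrit : vertex_critical k G.

(* Colours are natural numbers, so that no colour has to be invented for the
   vertices outside [A], even when [m = 0]. *)
Definition proper_on (A : {pred G}) (m : nat) (c : G -> nat) :=
  {in A, forall x, c x < m} /\ {in A &, forall x y, edge x y -> c x != c y}.

Lemma colorable_chi (H : sgraph) : colorable H (chi H).
Proof. by rewrite /chi; case: ex_minnP. Qed.

Lemma critical_colorable : colorable G k.
Proof. by case: Gcrit => <- _; apply: colorable_chi. Qed.

Lemma critical_not_colorable (c : G -> nat) : 0 < k -> ~ proper_on predT k.-1 c.
Proof.
case: Gcrit => chiG _ k0 [clt cP].
suff : chi G <= k.-1 by rewrite chiG -ltnS prednK // ltnn.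
rewrite /chi; case: ex_minnP => n _; apply.
apply/existsP; exists [ffun x => Ordinal (clt x isT)].
apply/forallP => x; apply/forallP => y; apply/implyP => /cP.
by rewrite !ffunE; apply.
Qed.

Lemma critical_del_colorable (v : G) :
  exists c : G -> nat, proper_on (predC1 v) k.-1 c.
Proof.
case: Gcrit => _ /(_ v) chiv.
have /existsP[c /forallP cP] := colorable_chi (del_vertex v).
(* The default 0 is taken at [v] alone, which [predC1 v] excludes. *)
exists (fun x => if insub x is Some y then val (c y) else 0); split.
  move=> x xv; case: insubP => [y _ _|/negP[]]; last by rewrite !inE.
  by rewrite (leq_trans (ltn_ord _)) // -ltnS prednK // (leq_ltn_trans _ chiv).
move=> x y xv yv exy.
case: insubP => [x' _ xx'|/negP[]]; last by rewrite !inE.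
case: insubP => [y' _ yy'|/negP[]]; last by rewrite !inE.
by move: (cP x') => /forallP/(_ y')/implyP; rewrite /= /induced_edge xx' yy' => /(_ exy).
Qed.

Hypothesis k_gt0 : 0 < k.

(** This is connectedness. If some [u] lay outside [S], a colouring of [G - u] on [S] and one of
    [G - v] off [S] would combine, since no edge leaves [S]. *)
Lemma critical_closed_full (S : {set G}) (v : G) : v \in S ->
  {in S, forall x y, edge x y -> y \in S} -> S = setT.
Proof.
move=> vS Sclosed; apply/setP => u; rewrite inE; apply/negbNE/negP => uS.
have [cu [cult cuP]] := critical_del_colorable u.
have [cv [cvlt cvP]] := critical_del_colorable v.
have Su x : x \in S -> x \in predC1 u.
  by move=> xS; rewrite inE; apply: contraNneq uS => <-.
have Sv x : x \notin S -> x \in predC1 v.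
  by move=> xS; rewrite inE; apply: contraNneq xS => ->.
apply: (@critical_not_colorable (fun x => if x \in S then cu x else cv x)) => //.
split=> [x _|x y _ _ xy].
  by case: ifPn => [/Su/cult|/Sv/cvlt].
have -> : (y \in S) = (x \in S).
  apply/idP/idP => [yS|xS]; last exact: Sclosed xy.
  by apply: (Sclosed y); rewrite // edge_sym.
case: ifPn => [xS|xS].
  by apply: cuP (xy); apply: Su => //; apply: Sclosed xy.
apply: cvP (xy); apply: Sv => //; apply: contra xS => yS.
by apply: (Sclosed y); rewrite // edge_sym.
Qed.

(** Recolouring each [x] in [A] like [f x] would turn a colouring of [G - v] with [k.-1] colours
    into one of [G]. *)
Lemma critical_no_folding (A : {set G}) (f : G -> G) (v : G) : v \in A ->
  {in A, forall x, f x \notin A} ->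
  {in A &, forall x y, edge x y -> edge (f x) (f y)} ->
  (forall x y, x \in A -> y \notin A -> edge x y -> edge (f x) y) -> False.
Proof.
move=> vA fA fE fO.
have [c [clt cP]] := critical_del_colorable v.
have Av x : x \notin A -> x \in predC1 v.
  by move=> xA; rewrite inE; apply: contraNneq xA => ->.
apply: (@critical_not_colorable (fun x => if x \in A then c (f x) else c x)) => //.
split=> [x _|x y _ _ xy].
  by case: ifPn => xA; apply: clt; apply: Av => //; apply: fA.
case: ifPn => xA; case: ifPn => yA; apply: cP; rewrite ?Av ?fA //.
- exact: fE.
- exact: fO.
- by rewrite edge_sym; apply: fO; rewrite // edge_sym.
Qed.

(** A proper colouring with [k] colours, composed with [b], is injective on [A]. *)
Lemma clique_image_bound (I : finType) (A : {set I}) (b : I -> G) :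
  {in A &, forall x y, x != y -> edge (b x) (b y)} -> #|A| <= k.
Proof.
move=> bA; have /existsP[c /forallP cP] := critical_colorable.
rewrite -[k in _ <= k]card_ord; have <- : #|(c \o b) @: A| = #|A|.
  apply: card_in_imset => x y xA yA /= cxy; apply/eqP/negPn/negP => ne.
  by have /forallP/(_ (b y))/implyP/(_ (bA x y xA yA ne)) := cP (b x); rewrite cxy eqxx.
exact: max_card.
Qed.

End Critical.

(** * The neighbourhood of a vertex *)

Section Neighbourhood.
Variable G : sgraph.
Hypotheses (P5G : induced_free P5 G) (DG : induced_free diamond G).
Variable d : G.

(* The neighbours of [a] at distance two from [d], for [a] adjacent to [d]. *)
Definition far_nbr (a : G) : {set G} :=
  [set b | [&& edge a b, b != d & ~~ edge d b]].

(** For [x] adjacent to [d] in a diamond-free graph, this is the component of [x] in the graph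
    induced on [N(d)]. *)
Definition nbr_clique (x : G) : {set G} :=
  [set y | edge d y & (y == x) || edge x y].

Lemma nbr_edge_trans (x y z : G) : edge d x -> edge d y -> edge d z ->
  y != z -> edge x y -> edge x z -> edge y z.
Proof.
move=> dx dy dz ne xy xz; apply/negPn/negP => nyz.
apply: (@no_diamond G y z x d) => //; by rewrite 1?edge_sym.
Qed.

(** Otherwise [b - a - d - a' - b'] would be an induced [P5]. *)
Lemma far_nbr_complete (a a' b b' : G) : edge d a -> edge d a' ->
  ~~ edge a a' -> b \in far_nbr a -> b' \in far_nbr a' ->
  ~~ edge a b' -> ~~ edge a' b -> edge b b'.
Proof.
rewrite !inE => da da' aa' /and3P[ab _ db] /and3P[ab' _ db'] nab' nab.
apply/negPn/negP => nbb.
by apply: (@no_P5 G b a d a' b') => //; rewrite 1?edge_sym.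
Qed.

(** A common neighbour [b] would form a diamond with [d], [a], [a'], lacking the edge [b d]. *)
Lemma far_nbr_disjoint (a a' b : G) : edge d a -> edge d a' -> edge a a' ->
  b \in far_nbr a -> ~~ edge a' b.
Proof.
rewrite !inE => da da' aa' /and3P[ab bd db]; apply/negP => ab'.
by apply: (@no_diamond G b d a a') => //; rewrite edge_sym.
Qed.

Lemma nbr_clique_edge (x y z : G) : edge d x ->
  y \in nbr_clique x -> z \in nbr_clique x -> y != z -> edge y z.
Proof.
rewrite !inE => dx /andP[dy /orP[/eqP->|xy]] /andP[dz /orP[/eqP->|xz]] ne.
- by rewrite eqxx in ne.
- by [].
- by rewrite edge_sym.
- exact: nbr_edge_trans ne xy xz.
Qed.

Lemma nbr_clique_closed (x y z : G) : edge d x ->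
  y \in nbr_clique x -> edge d z -> edge y z -> z \in nbr_clique x.
Proof.
rewrite !inE => dx /andP[dy yx] dz yz; rewrite dz /=.
case: eqP => //= /eqP zx; move: yx; case: eqP => [<- //|_ /= xy].
by apply: (@nbr_edge_trans y) => //; rewrite 1?eq_sym // edge_sym.
Qed.

Lemma nbr_clique_disjoint (x y z : G) : edge d x -> edge d y -> x != y ->
  ~~ edge x y -> z \in nbr_clique x -> z \notin nbr_clique y.
Proof.
move=> dx dy ne nxy zx; apply/negP => zy; move/negP: nxy; apply.
have [e|zny] := eqVneq z y.
  by move: zx; rewrite !inE e eq_sym (negbTE ne) => /andP[].
have yy : y \in nbr_clique y by rewrite inE dy eqxx.
have yx := nbr_clique_closed dx zx dy (nbr_clique_edge dy zy yy zny).
by apply: (nbr_clique_edge dx _ yx ne); rewrite inE dx eqxx.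
Qed.

Lemma nbr_clique_anticomplete (x y z w : G) : edge d x -> edge d y -> x != y ->
  ~~ edge x y -> z \in nbr_clique x -> w \in nbr_clique y -> ~~ edge z w.
Proof.
move=> dx dy ne nxy zx wy; apply/negP => zw.
have dw : edge d w by move: wy; rewrite inE => /andP[].
by have := nbr_clique_disjoint dx dy ne nxy (nbr_clique_closed dx zx dw zw); rewrite wy.
Qed.

(* Pick [b] in [far_nbr (u 4)], [c2] in [far_nbr (v 2)] outside [far_nbr (v 1)],
   and [c3] in [far_nbr (v 3)] outside [far_nbr (v 2)]. Both [c2] and [c3] are
   adjacent to [b] and cannot both be adjacent to [u 1] without creating a diamond;
   the one that is not gives the induced path [v 1 - u 1 - b - c - v 4]. *)
Lemma no_opposite_chains (u v : nat -> G) :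
  (forall i, i <= 5 -> [/\ edge d (u i), edge d (v i) & edge (u i) (v i)]) ->
  (forall i j, i <= 5 -> j <= 5 -> i != j -> ~~ edge (v i) (v j) /\ ~~ edge (u i) (v j)) ->
  (forall i j, i < j <= 5 -> far_nbr (u j) \subset far_nbr (u i)) ->
  (forall i j, i < j <= 5 -> far_nbr (v i) \subset far_nbr (v j)) ->
  (forall i j, i < j <= 5 -> ~~ (far_nbr (u i) \subset far_nbr (u j))) ->
  (forall i j, i < j <= 5 -> ~~ (far_nbr (v j) \subset far_nbr (v i))) -> False.
Proof.
move=> duv anti uD vI uN vN.
have [b b4 _] := subsetPn (uN 4 5 isT).
have [c2 c22 c21] := subsetPn (vN 1 2 isT).
have [c3 c33 c32] := subsetPn (vN 2 3 isT).
have c31 : c3 \notin far_nbr (v 1) by apply: contra c32; apply/subsetP/vI.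
have farE a x y : x \in far_nbr y -> (x \in far_nbr a) = edge a x.
  by rewrite !inE => /and3P[_ -> ->]; rewrite !andbT.
have [bd ndb] : b != d /\ ~~ edge d b by move: b4; rewrite inE => /and3P[].
have bu i : 0 < i < 5 -> b \in far_nbr (u i).
  case/andP=> i0 i5; have [->//|ne] := eqVneq i 4.
  by apply: (subsetP (uD i 4 _)) b4; rewrite ltn_neqAle ne -ltnS i5.
have bv i : 0 < i < 5 -> ~~ edge (v i) b.
  move=> i5; have /duv[dui dvi uvi] : i <= 5 by case/andP: i5 => _ /ltnW.
  exact: far_nbr_disjoint uvi (bu i i5).
(* Compare [u i] with [v 4]: [c] misses [u i] because it sees [v i], and [b] misses [v 4] because it
   sees [u 4]. *)
have bP i c : 1 < i < 4 -> c \in far_nbr (v i) -> edge b c /\ c \in far_nbr (v 4).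
  case/andP=> i1 i4 ci.
  have c4 : c \in far_nbr (v 4) by apply: (subsetP (vI i 4 _)) ci; rewrite i4.
  split=> //; have i5 : i <= 5 by rewrite ltnW // ltnW.
  have [dui dvi uvi] := duv i i5; have [_ dv4 _] := duv 4 isT.
  have [_ nuv] := anti i 4 i5 isT (negbT (ltn_eqF i4)).
  apply: (far_nbr_complete dui dv4 nuv _ c4).
  - by apply: bu; rewrite ltnW // ltnW.
  - by apply: (@far_nbr_disjoint (v i)) ci; rewrite // edge_sym.
  - exact: bv.
have [bc2 c24] := bP 2 c2 isT c22.
have [bc3 c34] := bP 3 c3 isT c33.
have [du1 dv1 uv1] := duv 1 isT.
have [du4 dv4 uv4] := duv 4 isT.
have [nv14 nu1v4] := anti 1 4 isT isT isT.
have b1 := bu 1 isT.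
have edgeF a x : x \in far_nbr a -> edge a x by rewrite inE => /and3P[].
have key c : edge b c -> c \in far_nbr (v 4) -> c \notin far_nbr (v 1) -> edge (u 1) c.
  move=> bc c4 c1; apply/negPn/negP => nuc.
  apply: (@no_P5 G (v 1) (u 1) b c (v 4)) => //.
  - by rewrite edge_sym.
  - exact: edgeF.
  - by rewrite edge_sym edgeF.
  - exact: bv.
  - by rewrite -(farE _ _ _ c4).
  - by rewrite edge_sym bv.
have u1c2 := key c2 bc2 c24 c21.
have u1c3 := key c3 bc3 c34 c31.
have c23 : c2 != c3 by apply: contraNneq c32 => <-.
(* The diamond is on [v 4, b, c2, c3] if [c2 c3] is an edge, and on [c2, c3, u 1, b] otherwise. *)
have [e23|n23] := boolP (edge c2 c3).
  apply: (@no_diamond G (v 4) b c2 c3) => //; rewrite ?bv ?edgeF //.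
  by apply: contraTneq dv4 => ->.
apply: (@no_diamond G c2 c3 (u 1) b) => //; rewrite 1?[edge c2 _]edge_sym 1?[edge c3 _]edge_sym //.
exact: edgeF.
Qed.

(** * Independent neighbours of [d] with incomparable far neighbourhoods *)

Section Incomparable.
Variable S : {set G}.
Hypotheses (Sd : {in S, forall x, edge d x})
  (Sindep : {in S &, forall x y, ~~ edge x y})
  (Sinc : {in S &, forall x y, x != y -> ~~ (far_nbr x \subset far_nbr y)}).

Let far (b : G) := (b != d) && ~~ edge d b.
Let trace (b : G) := [set y in S | edge y b].

Let far_nbrE (x b : G) : far b -> (b \in far_nbr x) = edge x b.
Proof. by rewrite inE /far => ->; rewrite andbT. Qed.

Let traceP (b x : G) : x \in trace b -> x \in S /\ edge x b.
Proof. by rewrite inE => /andP[]. Qed.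

Let trace_edge (b c : G) : far b -> far c ->
  ~~ (trace b \subset trace c) -> ~~ (trace c \subset trace b) -> edge b c.
Proof.
move=> fb fc /subsetPn[y /traceP[yS yb] yc] /subsetPn[z /traceP[zS zc] zb].
rewrite inE yS /= in yc; rewrite inE zS /= in zb.
apply: (far_nbr_complete (Sd yS) (Sd zS) (Sindep yS zS)) => //; by rewrite far_nbrE.
Qed.

(** Distinct [y] and [z] are nonadjacent, so they would form a diamond with [b] and [c]. *)
Let trace_meet (b c y z : G) : edge b c ->
  y \in trace b -> y \in trace c -> z \in trace b -> z \in trace c -> y = z.
Proof.
move=> bc /traceP[yS yb] /traceP[_ yc] /traceP[zS zb] /traceP[_ zc].
apply/eqP/negPn/negP => ne.
by apply: (@no_diamond G y z b c) => //; apply: Sindep.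
Qed.

(* At most one [x] in [S] is crossed; every other one has a private far neighbour
   (trace [[set x]]), and the private far neighbours form a clique. *)
Let crossed (x b b' : G) :=
  [&& far b, far b', x \in trace b, x \in trace b',
      ~~ (trace b \subset trace b') & ~~ (trace b' \subset trace b)].

(** Otherwise the trace of [c] is incomparable with both others, so [b], [b'], [c] are pairwise
    adjacent and form a diamond with [x]. *)
Let crossed_cover (x b b' c : G) : crossed x b b' -> far c -> x \notin trace c ->
  (trace c \subset trace b) || (trace c \subset trace b').
Proof.
case/and5P=> fb fb' xb xb' /andP[bb' b'b] fc xc.
apply/negPn/negP => /norP[cb cb'].
have bc : edge b c by apply: trace_edge => //; apply: contra xc => /subsetP; apply.
have bc' : edge b' c by apply: trace_edge => //; apply: contra xc => /subsetP; apply.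
have [xS ebx] := traceP xb; have [_ ebx'] := traceP xb'.
apply: (@no_diamond G x c b b') => //; rewrite 1?[edge c _]edge_sym //.
- by apply: contraTneq (Sd xS) => ->; case/andP: fc.
- by move: xc; rewrite inE xS.
- exact: trace_edge.
Qed.

(** The two traces already meet in [x], so [y] is not in both. It is in one of them by covering the
    trace of a far neighbour of [y] that misses [x]. *)
Let crossed_split (x y b b' : G) : crossed x b b' -> y \in S -> y != x ->
  (y \in trace b) (+) (y \in trace b').
Proof.
move=> xbb' yS ne; have [fb fb' xb xb' /andP[bb' b'b]] := and5P xbb'.
have xS := (traceP xb).1.
have [c cy cx] := subsetPn (Sinc yS xS ne).
have fc : far c by move: cy; rewrite inE => /andP[].
rewrite far_nbrE // in cy; rewrite far_nbrE // in cx.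
have yc : y \in trace c by rewrite inE yS.
have : (y \in trace b) || (y \in trace b').
  have xc : x \notin trace c by rewrite inE xS.
  by case/orP: (crossed_cover xbb' fc xc) => /subsetP ->; rewrite ?orbT.
have : ~~ ((y \in trace b) && (y \in trace b')).
  apply/negP => /andP[yb yb']; move/eqP: ne; apply.
  exact: trace_meet (trace_edge fb fb' bb' b'b) _ _ _ _.
by case: (y \in trace b) (y \in trace b') => [] [].
Qed.

Let crossedC (x b b' : G) : crossed x b b' -> crossed x b' b.
Proof. by case/and5P=> ? ? ? ? /andP[? ?]; apply/and5P; split=> //; apply/andP. Qed.

Let crossed_orient (x y b b' : G) : crossed x b b' -> y \in S -> y != x ->
  exists b b', [/\ crossed x b b', y \in trace b & y \notin trace b'].
Proof.
move=> xb yS ne; have := crossed_split xb yS ne.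
have [yb|yb] := boolP (y \in trace b) => /= yb'; first by exists b, b'.
by exists b', b; split=> //; apply: crossedC.
Qed.

(** Orient both pairs so that [b] and [c] each see [x] and [y]. The covering property then makes
    their traces incomparable, so [b] and [c] are adjacent and their traces meet only once. *)
Let crossed_unique (x y b b' c c' : G) :
  crossed x b b' -> crossed y c c' -> x = y.
Proof.
move=> xb yc; apply/eqP/negPn/negP => ne.
have xS : x \in S by case/and5P: xb => _ _ /traceP[].
have yS : y \in S by case/and5P: yc => _ _ /traceP[].
have yx : y != x by rewrite eq_sym.
have [{}b [{}b' [{}xb yb yb']]] := crossed_orient xb yS yx.
have [{}c [{}c' [{}yc xc xc']]] := crossed_orient yc xS ne.
have [fb fb' xtb xtb' /andP[bb' b'b]] := and5P xb.
have [fc fc' ytc ytc' /andP[cc' c'c]] := and5P yc.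
have c'Sb : trace c' \subset trace b.
  case/orP: (crossed_cover xb fc' xc') => // /subsetP/(_ _ ytc').
  by rewrite (negbTE yb').
have b'Sc : trace b' \subset trace c.
  case/orP: (crossed_cover yc fb' yb') => // /subsetP/(_ _ xtb').
  by rewrite (negbTE xc').
have [bc|nbc] := boolP (trace b \subset trace c).
  by rewrite (subset_trans c'Sb bc) in c'c.
have [cb|ncb] := boolP (trace c \subset trace b).
  by rewrite (subset_trans b'Sc cb) in b'b.
by move/eqP: ne; apply; apply: trace_meet (trace_edge fb fc nbc ncb) _ _ _ _.
Qed.

(** Take a far neighbour [b] of [x] with smallest trace. If the trace holds another [y], a far
    neighbour of [x] missing [y] crosses [b] by minimality. The vertex [z] only ensures that [x] has
    a far neighbour. *)
Let private_or_crossed (x z : G) : x \in S -> z \in S -> x != z ->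
  (exists2 b, far b & trace b = [set x]) \/ exists b b', crossed x b b'.
Proof.
move=> xS zS xz.
have [b0 xb0 _] := subsetPn (Sinc xS zS xz).
have [b xb bmin] := @arg_minnP G b0 (fun b => b \in far_nbr x) (fun b => #|trace b|) xb0.
have fb : far b by move: xb; rewrite inE => /andP[].
have xtb : x \in trace b by rewrite inE xS -far_nbrE.
have [b1|nb1] := eqVneq (trace b) [set x]; first by left; exists b.
right; have [y yb xy] : exists2 y, y \in trace b & x != y.
  have : ~~ (trace b \subset [set x]).
    by apply: contra nb1 => sub; rewrite eqEsubset sub sub1set.
  by case/subsetPn=> y yb; rewrite inE eq_sym; exists y.
have yS := (traceP yb).1.
have [b' xb' yb'] := subsetPn (Sinc xS yS xy).
have fb' : far b' by move: xb'; rewrite inE => /andP[].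
have nbb' : ~~ (trace b \subset trace b').
  by apply/subsetPn; exists y; rewrite // inE yS -far_nbrE.
exists b, b'; rewrite /crossed fb fb' xtb nbb' inE xS -far_nbrE // xb' /=.
apply/negP => sub; have := bmin b' xb'; rewrite leqNgt => /negP; apply.
by apply: proper_card; rewrite properE sub.
Qed.

Lemma incomparable_bound (k : nat) : vertex_critical k G -> #|S| <= k.+1.
Proof.
move=> Gcrit; have [S1|S1] := leqP #|S| 1; first exact: leq_trans S1 _.
pose priv x b := far b && (trace b == [set x]).
pose A := [set x in S | [exists b, priv x b]].
have Ak : #|A| <= k.
  (* The default is never taken on [A]. Private neighbours of distinct vertices have incomparable
     singleton traces, hence are adjacent. *)
  apply: (clique_image_bound Gcrit (b := fun x => odflt x [pick b | priv x b])).
  move=> x y; rewrite !inE => /andP[xS /existsP[b0 xb0]] /andP[yS /existsP[c0 yc0]] ne.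
  case: pickP => [b /andP[fb /eqP bx]|/(_ b0)]; last by rewrite xb0.
  case: pickP => [c /andP[fc /eqP cy]|/(_ c0)]; last by rewrite yc0.
  apply: trace_edge => //; rewrite bx cy sub1set inE //.
  by rewrite eq_sym.
have SA : #|S :\: A| <= 1.
  apply/card_le1_eqP => x y; rewrite !inE.
  have crossP z : ~~ ((z \in S) && [exists b, priv z b]) && (z \in S) ->
    exists b b', crossed z b b'.
    case/andP=> nz zS; rewrite zS /= in nz.
    have [w wS zw] : exists2 w, w \in S & z != w.
      have /card_gt1P[u [v [uS vS uv]]] := S1.
      by have [e|] := eqVneq z u; [exists v; rewrite // e | exists u].
    case: (private_or_crossed zS wS zw) => // -[b fb bz].
    by case/existsP: nz; exists b; rewrite /priv fb bz eqxx.
  by move=> /crossP[b [b' xb]] /crossP[c [c' yc]]; apply: crossed_unique yc xb.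
rewrite -(cardsID A) -addn1 leq_add // (leq_trans _ Ak) // subset_leq_card //.
exact: subsetIr.
Qed.

End Incomparable.

(** * Labelled cliques and folding *)

(** Labels match cliques of equal size vertex by vertex. Out of range the label falls back to [x],
    so that all labels below [k] can enter a Ramsey colour. *)
Definition clique_label (x : G) (p : nat) : G := nth x (enum (nbr_clique x)) p.

Lemma clique_label_mem (x : G) (p : nat) : p < #|nbr_clique x| ->
  clique_label x p \in nbr_clique x.
Proof. by move=> pr; rewrite -mem_enum mem_nth // -cardE. Qed.

Lemma nbr_clique_nbr (x y : G) : y \in nbr_clique x -> edge d y.
Proof. by rewrite inE => /andP[]. Qed.

Lemma clique_label_edge (x : G) (p q : nat) : edge d x ->
  p < #|nbr_clique x| -> q < #|nbr_clique x| -> p != q ->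
  edge (clique_label x p) (clique_label x q).
Proof.
move=> dx pr qr ne; apply: (nbr_clique_edge dx); rewrite ?clique_label_mem //.
by rewrite nth_uniq ?enum_uniq // -cardE.
Qed.

Lemma nbr_clique_card (k : nat) (x : G) : vertex_critical k G -> edge d x ->
  #|nbr_clique x| <= k.
Proof.
move=> Gcrit dx; apply: (clique_image_bound Gcrit (b := id)) => y z.
exact: nbr_clique_edge.
Qed.

(** If all inclusions held, sending each vertex to the one with the same label would fold the clique
    of [x] onto that of [y]. *)
Lemma clique_label_not_subset (k : nat) (x y : G) :
  vertex_critical k G -> 0 < k -> edge d x -> edge d y -> x != y -> ~~ edge x y ->
  #|nbr_clique x| = #|nbr_clique y| ->
  exists2 p, p < #|nbr_clique x| &
    ~~ (far_nbr (clique_label x p) \subset far_nbr (clique_label y p)).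
Proof.
move=> Gcrit k0 dx dy ne nxy exy.
have [/existsP[p Hp]|/existsPn sub] := boolP [exists p : 'I_#|nbr_clique x|,
  ~~ (far_nbr (clique_label x p) \subset far_nbr (clique_label y p))].
  by exists p.
exfalso; pose f z := clique_label y (index z (enum (nbr_clique x))).
have ix z : z \in nbr_clique x -> index z (enum (nbr_clique x)) < #|nbr_clique x|.
  by move=> zx; rewrite cardE index_mem mem_enum.
have fy z : z \in nbr_clique x -> f z \in nbr_clique y.
  by move=> /ix; rewrite exy; apply: clique_label_mem.
have xx : x \in nbr_clique x by rewrite inE dx eqxx.
apply: (critical_no_folding Gcrit k0 (f := f) xx).
- move=> z /fy zy; apply: nbr_clique_disjoint zy => //; first by rewrite eq_sym.
  by rewrite edge_sym.
- move=> z w zx wx zw; apply: clique_label_edge; rewrite -?exy ?ix //.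
  apply: contraTneq zw => izw.
  rewrite -(nth_index x (s := enum (nbr_clique x)) (x := z)) ?mem_enum //.
  by rewrite izw nth_index ?mem_enum // edge_irrefl.
- move=> z w zx wx zw.
  have dz := nbr_clique_nbr zx; have dfz := nbr_clique_nbr (fy z zx).
  (* A neighbour of [z] outside its clique is [d] or a far neighbour; the assumed inclusion handles
     the latter. *)
  have [->|wd] := eqVneq w d; first by rewrite edge_sym.
  have [dw|dw] := boolP (edge d w).
    by rewrite (nbr_clique_closed dx zx dw zw) in wx.
  have := sub (Ordinal (ix z zx)); rewrite negbK /= /clique_label nth_index ?mem_enum //.
  by move=> /subsetP/(_ w); rewrite !inE zw wd dw => /(_ isT)/andP[].
Qed.

End Neighbourhood.

(** * The degree bound *)

Lemma degree_bound (k : nat) : 0 < k -> exists D, forall G : sgraph,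
  vertex_critical k G -> induced_free P5 G -> induced_free diamond G ->
  forall d : G, #|[set x | edge d x]| <= D.
Proof.
move=> k0.
(* A colour records adjacency, the size of the first clique, and both inclusions for each label. The
   last of the [k + 7] vertices is never first in a pair, so sizes are known for [k + 6]: more than
   [k.+1] for the incomparable case, and at least six for the chains. *)
have [N HN] := ramsey
  (true, ord0 : 'I_k.+1, [ffun=> (true, true)] : {ffun 'I_k -> bool * bool}) (k + 7).
exists N => G Gcrit P5G DG d; rewrite leqNgt; apply/negP => /ltnW Nd.
pose Q := nbr_clique d; pose a := clique_label d; pose F x := far_nbr d x.
pose col x y := (edge x y, inord #|Q x| : 'I_k.+1,
  [ffun p : 'I_k => (F (a x p) \subset F (a y p), F (a y p) \subset F (a x p))]).
rewrite cardE in Nd.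
have [[[e r] f] [t [ts tk /(pairwiseP d) tP]]] := HN G col _ Nd.
have tu : uniq t by apply: subseq_uniq ts (enum_uniq _).
pose x i := nth d t i.
have xd i : i < k + 7 -> edge d (x i).
  move=> ik; have : x i \in enum [set x | edge d x].
    by apply: (mem_subseq ts); apply: mem_nth; apply: leq_trans tk.
  by rewrite mem_enum inE.
have x_neq i j : i < k + 7 -> j < k + 7 -> i != j -> x i != x j.
  by move=> ik jk ij; rewrite nth_uniq // (leq_trans _ tk).
have colP i j : i < j < k + 7 -> [/\ edge (x i) (x j) = e, #|Q (x i)| = r
    & forall p : 'I_k, f p = (F (a (x i) p) \subset F (a (x j) p),
                              F (a (x j) p) \subset F (a (x i) p))].
  case/andP=> ij jk; have ik := ltn_trans ij jk.
  have /eqP[<- <- <-] := tP i j (leq_trans ik tk) (leq_trans jk tk) ij.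
  split=> // [|p]; last by rewrite ffunE.
  by rewrite inordK // ltnS (nbr_clique_card DG Gcrit) // xd.
have e0 : e = false.
  apply/negbTE/negP => e1.
  have : #|[set: 'I_(k + 7)]| <= k.
    apply: (clique_image_bound Gcrit (b := fun i : 'I_(k + 7) => x i)) => i j _ _.
    rewrite -val_eqE neq_ltn => /orP[] ij.
      by have [|-> _ _] := colP i j; rewrite ?ij ?ltn_ord.
    by rewrite edge_sym; have [|-> _ _] := colP j i; rewrite ?ij ?ltn_ord.
  by rewrite cardsT card_ord -[X in _ <= X]addn0 leq_add2l.
have x_indep i j : i < k + 7 -> j < k + 7 -> i != j -> ~~ edge (x i) (x j).
  move=> ik jk; rewrite neq_ltn => /orP[] ij.
    by have [|-> _ _] := colP i j; rewrite ?ij ?e0.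
  by rewrite edge_sym; have [|-> _ _] := colP j i; rewrite ?ij ?e0.
have Qr i : i < k + 6 -> #|Q (x i)| = r.
  by move=> ik; have [|_ -> _] := colP i (k + 6); rewrite ?ik ?ltn_add2l.
have k6 i : i < k + 6 -> i < k + 7 by move=> ik; rewrite addnS ltnW.
have rk : r <= k by rewrite -ltnS.
have aQ i p : i < k + 6 -> p < r -> a (x i) p \in Q (x i).
  by move=> ik pr; apply: clique_label_mem; rewrite -/Q Qr.
have ad i p : i < k + 6 -> p < r -> edge d (a (x i) p).
  by move=> ik /(aQ i p ik); apply: nbr_clique_nbr.
have anti i j p q : i < k + 6 -> j < k + 6 -> p < r -> q < r -> i != j ->
    ~~ edge (a (x i) p) (a (x j) q).
  move=> ik jk pr qr ij.
  apply: (nbr_clique_anticomplete DG _ _ _ _ (aQ i p ik pr) (aQ j q jk qr)).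
  - exact/xd/k6.
  - exact/xd/k6.
  - by apply: x_neq => //; apply: k6.
  - by apply: x_indep => //; apply: k6.
have lt01 : 0 < 1 < k + 7 by rewrite /= ltn_addl.
have lt0 : 0 < k + 6 by rewrite ltn_addl.
have lt1 : 1 < k + 6 by rewrite ltn_addl.
have notsub i j : i < k + 6 -> j < k + 6 -> i != j ->
  exists2 p, p < r & ~~ (F (a (x i) p) \subset F (a (x j) p)).
  move=> ik jk ij; rewrite -(Qr i ik).
  apply: (clique_label_not_subset DG Gcrit k0); rewrite ?xd ?k6 ?x_neq ?x_indep ?k6 //.
  by rewrite -/Q !Qr.
(* By homogeneity, one failed inclusion in each direction fixes the behaviour of labels [p] and [q]
   on all pairs. *)
have [p pr p01] := notsub 0 1 lt0 lt1 isT.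
have [q qr q10] := notsub 1 0 lt1 lt0 isT.
pose p' := Ordinal (leq_trans pr rk); pose q' := Ordinal (leq_trans qr rk).
have fp : (f p').1 = false by have [_ _ ->] := colP 0 1 lt01; apply/negbTE.
have fq : (f q').2 = false by have [_ _ ->] := colP 0 1 lt01; apply/negbTE.
have inc (s : 'I_k) : s < r -> f s <> (false, false).
  move=> sr fs; pose S := [set a (x i) s | i : 'I_(k + 6)].
  have : #|S| <= k.+1.
    apply: (@incomparable_bound G P5G DG d) => //.
    - by move=> _ /imsetP[i _ ->]; apply: ad.
    - move=> _ _ /imsetP[i _ ->] /imsetP[j _ ->].
      by have [->|ij] := eqVneq i j; rewrite ?edge_irrefl // anti.
    - move=> _ _ /imsetP[i _ ->] /imsetP[j _ ->] ne.
      have : i != j by apply: contraNneq ne => ->.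
      rewrite -val_eqE neq_ltn => /orP[] ij.
        have [|_ _ /(_ s)] := colP i j; first by rewrite ij k6.
        by rewrite fs => -[<- _].
      have [|_ _ /(_ s)] := colP j i; first by rewrite ij k6.
      by rewrite fs => -[_ <-].
  rewrite card_imset ?card_ord; first by rewrite -[k.+1]addn1 leq_add2l.
  move=> i j aij; apply/eqP/negPn/negP => ij.
  have ne : x i != x j by apply: x_neq; rewrite ?k6.
  have nij : ~~ edge (x i) (x j) by apply: x_indep; rewrite ?k6.
  have := nbr_clique_disjoint DG (xd i (k6 i (ltn_ord i))) (xd j (k6 j (ltn_ord j))) ne nij
    (aQ i s (ltn_ord i) sr).
  by rewrite aij aQ.
(* With incomparability excluded, label [p] strictly decreases and label [q] strictly increases. *)
have {}fp : f p' = (false, true).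
  by have := inc p' pr; case: (f p') fp => [[] []].
have {}fq : f q' = (true, false).
  by have := inc q' qr; case: (f q') fq => [[] []].
have pq : p != q.
  by apply: contra_eq_neq fp => epq; rewrite (_ : p' = q') ?fq //; apply: val_inj.
have lt5 i : i <= 5 -> i < k + 6 by move=> i5; rewrite ltn_addl.
have lt57 i j : i < j <= 5 -> i < j < k + 7 by case/andP=> -> /lt5/k6.
apply: (@no_opposite_chains G P5G DG d (fun i => a (x i) p) (fun i => a (x i) q)).
- move=> i /lt5 ik; split; [exact: ad|exact: ad|].
  by apply: clique_label_edge; rewrite -/Q ?Qr // xd // k6.
- by move=> i j /lt5 ik /lt5 jk ij; split; apply: anti.
- by move=> i j /lt57/colP[_ _ /(_ p')]; rewrite fp => -[_ <-].
- by move=> i j /lt57/colP[_ _ /(_ q')]; rewrite fq => -[<- _].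
- by move=> i j /lt57/colP[_ _ /(_ p')]; rewrite fp => -[<- _].
- by move=> i j /lt57/colP[_ _ /(_ q')]; rewrite fq => -[_ <-].
Qed.

(** * Balls and connectedness *)

Definition ball (G : sgraph) (v : G) (n : nat) : {set G} :=
  iter n (fun B => B :|: \bigcup_(x in B) [set y | edge x y]) [set v].

Lemma ball_edge (G : sgraph) (v x y : G) (n : nat) :
  x \in ball v n -> edge x y -> y \in ball v n.+1.
Proof. by move=> xB xy; rewrite inE; apply/orP; right; apply/bigcupP; exists x; rewrite ?inE. Qed.

Lemma ball_predecessor (G : sgraph) (v x : G) (n : nat) :
  x \in ball v n.+1 -> x \notin ball v n -> exists2 y, y \in ball v n & edge y x.
Proof. by rewrite inE => /orP[->//|/bigcupP[y yB]]; rewrite inE; exists y. Qed.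

Lemma card_ball (G : sgraph) (v : G) (D n : nat) :
  (forall d : G, #|[set x | edge d x]| <= D) -> #|ball v n| <= D.+1 ^ n.
Proof.
move=> degD; elim: n => [|n IHn]; first by rewrite cards1.
rewrite /= (leq_trans (leq_card_setU _ _)) // expnS mulSn leq_add //.
rewrite mulnC (leq_trans _ (leq_mul IHn (leqnn D))) //.
rewrite -sum_nat_const.
apply: (big_ind2 (fun (A : {set G}) m => #|A| <= m)) => //; first by rewrite cards0.
by move=> A a B b Aa Bb; rewrite (leq_trans (leq_card_setU _ _)) ?leq_add.
Qed.

(* A shortest path leaving the ball of radius three would be an induced [P5]. *)
Lemma critical_ball3 (G : sgraph) (k : nat) (v : G) : vertex_critical k G -> 0 < k ->
  induced_free P5 G -> ball v 3 = setT.
Proof.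
move=> Gcrit k0 P5G.
have step n : ball v n \subset ball v n.+1 by apply: subsetUl.
apply: (critical_closed_full Gcrit k0 (v := v)).
  by rewrite !inE eqxx.
move=> x3 x33 x4 e34; apply/negPn/negP => x43.
have far x y n : x \notin ball v n.+1 -> y \in ball v n -> ~~ edge y x.
  by move=> xn yn; apply: contra xn; apply: ball_edge.
have x32 : x3 \notin ball v 2 by apply: contraTN e34; apply: far.
have [x2 x22 e23] := ball_predecessor x33 x32.
have x21 : x2 \notin ball v 1 by apply: contraTN e23; apply: far.
have [x1 x11 e12] := ball_predecessor x22 x21.
have x10 : x1 \notin ball v 0 by apply: contraTN e12; apply: far.
have [x0 x00 e01] := ball_predecessor x11 x10.
have x01 := subsetP (step _) _ x00; have x02 := subsetP (step _) _ x01.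
have x12 := subsetP (step _) _ x11.
by apply: (no_P5 P5G e01 e12 e23 e34); apply: far; eassumption.
Qed.

(** * Finiteness from bounded order *)

(** Symmetrising and removing loops makes every boolean table a graph, so the codes form a finite
    type without side conditions. *)
Definition code_edge (n : nat) (E : {ffun 'I_n * 'I_n -> bool}) : rel 'I_n :=
  fun i j => (i != j) && (E (i, j) || E (j, i)).

Lemma code_edge_sym n (E : {ffun 'I_n * 'I_n -> bool}) : symmetric (code_edge E).
Proof. by move=> i j; rewrite /code_edge eq_sym orbC. Qed.

Lemma code_edge_irrefl n (E : {ffun 'I_n * 'I_n -> bool}) : irreflexive (code_edge E).
Proof. by move=> i; rewrite /code_edge eqxx. Qed.

Lemma bounded_order_finitely_many (P : sgraph -> Prop) (N : nat) :
  (forall G, P G -> #|G| <= N) -> finitely_many_up_to_iso P.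
Proof.
move=> PN; pose T := {n : 'I_N.+1 & {ffun 'I_n * 'I_n -> bool}}.
exists #|{: T}|, (fun i => let t := enum_val i in
  SGraph (code_edge_sym (tagged t)) (code_edge_irrefl (tagged t))).
move=> G /PN GN; have GN' : #|G| < N.+1 by [].
pose E : {ffun 'I_#|G| * 'I_#|G| -> bool} := [ffun p => edge (enum_val p.1 : G) (enum_val p.2)].
pose t : T := Tagged (fun n : 'I_N.+1 => {ffun 'I_n * 'I_n -> bool}) (i := Ordinal GN') E.
exists (enum_rank t); rewrite enum_rankK /=.
exists (fun x : G => enum_rank x); split; first exact: enum_rank_bij.
move=> x y; rewrite /= /code_edge !ffunE /= !enum_rankK [edge y x]edge_sym orbb.
rewrite (inj_eq enum_rank_inj); case: eqP => //= ->.
by rewrite edge_irrefl.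
Qed.

Theorem theorem17 (k : nat) (hk : 1 <= k) :
  finitely_many_up_to_iso (fun G : sgraph =>
    [/\ vertex_critical k G, induced_free P5 G & induced_free diamond G]).
Proof.
have [D HD] := degree_bound hk.
apply: (@bounded_order_finitely_many _ (D.+1 ^ 3)) => G [Gcrit P5G DG].
(* The ball needs a centre; the empty graph satisfies the bound trivially. *)
have [v _|G0] := pickP (mem G); last by rewrite eq_card0.
rewrite -cardsT -(critical_ball3 v Gcrit hk P5G).
exact: card_ball (HD G Gcrit P5G DG).
Qed.
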